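(* A collection $\mathcal C$ of languages over a countably infinite universe $U$ is generatable in the limit without samples if and only if there exists a countable sequence of collections $\mathcal C_0\subseteq\mathcal C_1\subseteq\cdots$ such that $\mathcal C=\bigcup_{i\in\mathbb N}\mathcal C_i$ and $\bigl|\bigcap_{L\in\mathcal C_i}L\bigr|=\infty$ for all $i\in\mathbb N$.
   Context: A language is an infinite subset of $U$; a collection is a (possibly uncountable) set of languages. A generator without samples is an injection $G:\mathbb N\to U$, with output $z_t=G(t)$ at time $t$. $G$ generates in the limit without samples for $\mathcal C$ if for every $K\in\mathcal C$ there exists $t^\star$ such that $z_t\in K$ for all $t\ge t^\star$; $\mathcal C$ is generatable in the limit without samples if such a $G$ exists. *)

(* Defs.v *)
From mathcomp Require Import all_boot.
From mathcomp Require Import all_classical.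

Set Implicit Arguments.
Unset Strict Implicit.
Unset Printing Implicit Defensive.

Local Open Scope classical_set_scope.

Section Generation.
Variable U : Type.

Definition language (L : set U) : Prop := infinite_set L.

Definition collection (C : set (set U)) : Prop := forall L, C L -> language L.

Definition generates_without_samples (G : nat -> U) (C : set (set U)) : Prop :=
  forall K, C K -> exists tstar : nat, forall t : nat, tstar <= t -> K (G t).

Definition generatable_without_samples (C : set (set U)) : Prop :=
  exists G : nat -> U, injective G /\ generates_without_samples G C.

End Generation.

(* Main.v *)
(** If [G] generates, let [C_i] collect the languages of [C] containing every
    [G t] with [t >= i]: their intersection contains the infinite tail of [G].
    Conversely, the intersections of the [C_i] are infinite, so one can pick
    [G t] in the [t]-th one, distinct from the earlier outputs; since the
    [C_i] increase, a language of [C_i] contains [G t] for all [t >= i]. *)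
Require Import Defs.
From mathcomp Require Import all_boot.
From mathcomp Require Import all_classical.

Local Open Scope classical_set_scope.

Lemma infinite_image {T T' : Type} {A : set T} {f : T -> T'} :
  {in A &, injective f} -> infinite_set A -> infinite_set (f @` A).
Proof. by move=> f_inj; rewrite (eq_finite_set (inj_card_eq f_inj)). Qed.

Lemma infinite_nat_ge (i : nat) : infinite_set [set t | i <= t].
Proof.
apply: sub_infinite_set (infinite_setD infinite_nat (finite_II i)).
by move=> t [_ /negP]; rewrite -leqNgt.
Qed.

Lemma image_recursion {U : Type} (next : set U -> nat -> U) :
  exists G : nat -> U, forall t, G t = next (G @` `I_t) t.
Proof.
pose past := fix past t :=
  if t is s.+1 then past s `|` [set next (past s) s] else set0.
exists (fun t => next (past t) t) => t; congr next.
elim: t => [|t IHt]; first by rewrite II0 image_set0.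
by rewrite IIS image_setU image_set1 -IHt.
Qed.

Lemma fresh_injective {U : Type} {G : nat -> U} :
  (forall t, ~ (G @` `I_t) (G t)) -> injective G.
Proof.
move=> fresh s t Gst; case: (ltngtP s t) => // [s_lt_t|t_lt_s].
- by case: (fresh t); exists s.
- by case: (fresh s); exists t.
Qed.

Lemma injective_selection {U : Type} {A : nat -> set U} :
  (forall t, infinite_set (A t)) ->
  exists2 G : nat -> U, injective G & forall t, A t (G t).
Proof.
move=> A_inf.
have avoid (p : set U * nat) :
    exists x, finite_set p.1 -> (A p.2 `\` p.1) x.
  have [S_fin|S_inf] := pselect (finite_set p.1).
    by have [x] := infinite_setN0 (infinite_setD (A_inf p.2) S_fin); exists x.
  by have [x] := infinite_setN0 S_inf; exists x.
have [next nextP] := choice avoid.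
have [G G_next] := image_recursion (fun S t => next (S, t)).
have G_fresh t : (A t `\` (G @` `I_t)) (G t).
  rewrite {1}G_next; apply: (nextP (_, t)).
  exact: finite_image (finite_II t).
exists G => [|t]; last by have [] := G_fresh t.
by apply: fresh_injective => t; have [] := G_fresh t.
Qed.

Section Generators.
Context {U : Type}.
Implicit Types (G : nat -> U) (C : set (set U)) (Cs : nat -> set (set U)).

Definition tail G (i : nat) : set U := G @` [set t | i <= t].

Definition containing_tail G C (i : nat) : set (set U) :=
  [set K | C K /\ tail G i `<=` K].

Lemma infinite_tail G i : injective G -> infinite_set (tail G i).
Proof.
by move=> G_inj; apply: infinite_image (infinite_nat_ge i) => s t _ _ /G_inj.
Qed.

Lemma tailS G i : tail G i.+1 `<=` tail G i.
Proof. by apply: image_subset => t; apply: ltnW. Qed.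

Lemma containing_tailS G C i :
  containing_tail G C i `<=` containing_tail G C i.+1.
Proof.
by move=> K [CK tailK]; split=> //; apply: subset_trans (tailS G i) tailK.
Qed.

Lemma tail_sub_bigcap G C i :
  tail G i `<=` \bigcap_(L in containing_tail G C i) L.
Proof. by apply: sub_bigcap => L []. Qed.

Lemma bigcup_containing_tail G C :
  generates_without_samples G C -> C = \bigcup_i containing_tail G C i.
Proof.
move=> G_gen; apply/seteqP; split=> [K CK|K [i _ []] //].
have [i K_ge] := G_gen K CK.
by exists i => //; split=> // _ [t /K_ge ? <-].
Qed.

Lemma selection_generates_bigcup G Cs :
    (forall i, Cs i `<=` Cs i.+1) ->
    (forall t, (\bigcap_(L in Cs t) L) (G t)) ->
  generates_without_samples G (\bigcup_i Cs i).
Proof.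
move=> Cs_incr G_in K [i _ CsK]; exists i => t it.
have Cs_it := homo_leq (@subset_refl _) (@subset_trans _) Cs_incr it.
exact: G_in (Cs_it K CsK).
Qed.

End Generators.

Theorem theorem1p3 (U : Type) (U_countable : countable [set: U])
    (U_infinite : infinite_set [set: U])
    (C : set (set U)) (C_collection : collection C) :
  generatable_without_samples C <->
  exists Cs : nat -> set (set U),
    [/\ forall i : nat, collection (Cs i),
        forall i : nat, Cs i `<=` Cs i.+1,
        C = \bigcup_(i in [set: nat]) Cs i
      & forall i : nat, infinite_set (\bigcap_(L in Cs i) L)].
Proof.
split=> [[G [G_inj G_gen]]|[Cs [_ Cs_incr -> Cs_inf]]].
  exists (containing_tail G C); split.
  - by move=> i K [/C_collection].
  - exact: containing_tailS.
  - exact: bigcup_containing_tail.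
  - move=> i; apply: sub_infinite_set (tail_sub_bigcap G C i) _.
    exact: infinite_tail.
have [G G_inj G_in] := injective_selection Cs_inf.
by exists G; split=> //; apply: selection_generates_bigcup.
Qed.
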